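(* Every infinite-dimensional Banach space $X$ admits a subspace-hypercyclic operator; that is, there exist a bounded linear operator $T : X \to X$, a subspace $M \subsetneq X$ and a vector $x \in X$ such that $\operatorname{orb}(x,T) \cap M$ is dense in $M$.
   Context: For a bounded linear operator $T$ on a Banach space $X$ and $x \in X$, $\operatorname{orb}(x,T) := \{T^n x : n \geq 0\}$. The operator $T$ is called subspace-hypercyclic if there is a subspace $M \subsetneq X$ and a vector $x \in X$ such that $\operatorname{orb}(x,T) \cap M$ is dense in $M$; in this case $T$ is also called $M$-hypercyclic and $x$ an $M$-hypercyclic vector for $T$. The space $X$ is not assumed separable. *)

(* Defs.v *)
From HB Require Import structures.
From mathcomp Require Import all_boot all_order all_algebra.
From mathcomp Require Import all_classical all_reals all_analysis.
From mathcomp Require Import complex.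
Set Implicit Arguments.
Unset Strict Implicit.
Unset Printing Implicit Defensive.
Import Order.TTheory GRing.Theory Num.Theory.
Import numFieldNormedType.Exports.
Local Open Scope classical_set_scope.
Local Open Scope ring_scope.

Definition finite_dimensional (K : numFieldType) (X : lmodType K) : Prop :=
  exists (n : nat) (e : 'I_n -> X),
    forall x : X, exists c : 'I_n -> K, x = \sum_(i < n) c i *: e i.

Definition infinite_dimensional (K : numFieldType) (X : lmodType K) : Prop :=
  ~ finite_dimensional X.

Definition bounded_operator (K : numFieldType) (X : normedModType K)
    (T : {linear X -> X}) : Prop :=
  exists C : K, forall x : X, `|T x| <= C * `|x|.

Definition closed_subspace (K : numFieldType) (X : normedModType K)
    (M : set X) : Prop :=
  submod_closed (mem M) /\ closed M.

Definition orb (X : Type) (x : X) (T : X -> X) : set X :=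
  range (fun n : nat => iter n T x).

(* Subspaces are closed, as usual for Banach spaces.  The zero subspace is
   excluded: with it every operator would qualify, taking [x = 0].
   The last clause is density in the relative topology of [M], since the
   closure of a set [A `<=` M] relative to [M] is [closure A `&` M]. *)
Definition subspace_hypercyclic_for (K : numFieldType) (X : normedModType K)
    (T : {linear X -> X}) (M : set X) (x : X) : Prop :=
  [/\ closed_subspace M, M <> [set 0], M `<` [set: X] &
      M `<=` closure (orb x T `&` M)].

Definition subspace_hypercyclic (K : numFieldType) (X : normedModType K)
    (T : {linear X -> X}) : Prop :=
  exists (M : set X) (x : X), subspace_hypercyclic_for T M x.

(* Main.v *)
Require Import Defs.
From HB Require Import structures.
From mathcomp Require Import all_boot all_order all_algebra.
From mathcomp Require Import all_classical all_reals all_analysis.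
From mathcomp Require Import complex.
From mathcomp Require Import ring lra.
Import Order.TTheory GRing.Theory Num.Theory.
Import numFieldNormedType.Exports.
Local Open Scope classical_set_scope.
Local Open Scope ring_scope.

Set Implicit Arguments.
Unset Strict Implicit.
Unset Printing Implicit Defensive.

(** A weighted backward shift perturbing the identity is made to act on [X]
    as translation acts on polynomials, and translation of polynomials is
    topologically transitive for a trivial reason.

    The Hahn-Banach theorem gives enough bounded functionals on [X] to build,
    when [X] is infinite-dimensional, an infinite biorthogonal sequence
    [(e_n, f_n)].  The series [S x = \sum_j g_j(x) h_j], where [h_j] is a
    multiple of [e_(j+1)] and [g_j] a multiple of [f_(j+2)], converges
    absolutely once the multiples are well chosen, and [T = I + S] satisfies
    [T h_0 = h_0] and [T h_(j+1) = h_(j+1) + h_j] ([exists_backward_chain]).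
    Since [f_0] is continuous, nonzero and kills every [h_j], the closed span
    of the [h_j] is a proper subspace.

    Newton's forward difference formula turns this chain into translation:
    the linear map [newton h], which sends the binomial polynomial
    [x(x-1)...(x-j+1)/j!] to [h_j], intertwines [p(x) |-> p(x+1)] with [T]
    ([newton_translate]).  The subspace [M] is the closure of its range.

    Given polynomials [p] and [q] and [m > deg p, deg q], put
    [r_n(x) = p(x) (1 - x/n)^m + q(x-n) (x/n)^m].  As [n] grows, the
    coefficients of [r_n] converge to those of [p], while
    [r_n(x+n) = p(x+n) (-x/n)^m + q(x) (1 + x/n)^m] converges to [q].  Both
    sequences are sums of values at [1/n] and [-1/n] of polynomials with
    polynomial coefficients ([translate_fade]), so any linear map into a normed space
    preserves the two limits ([newton_transitive]).  Choosing such
    corrections successively, each so small that it spoils none of the earlier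
    approximations, yields a vector of [M] whose orbit comes close to every
    term of a sequence dense in [M] ([exists_hypercyclic_vector]).

    All of this is carried out over a scalar field [K] that is archimedean and
    has a countable dense subset, for spaces whose points are separated by
    bounded functionals; the real and the complex case differ only in the
    proofs of these three properties. *)

(** * Hahn-Banach theorem at a point *)

(** Only the inequality is asked for in the homogeneity clause: applied to [t]
    and [t^-1] it gives the equality, and it is easier to check for infima. *)
Definition sublinear (R : realType) (V : lmodType R) (q : V -> R) : Prop :=
  (forall x y, q (x + y) <= q x + q y) /\
  (forall t x, 0 < t -> q (t *: x) <= t * q x).

Lemma sublinear0 (R : realType) (V : lmodType R) (q : V -> R) :
  sublinear q -> q 0 = 0.
Proof.
case=> _ qZ.
have := qZ 2 0 (ltr0n _ 2); have := qZ 2^-1 0 ltac:(by rewrite invr_gt0 ltr0n).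
rewrite !scaler0 => h1 h2; lra.
Qed.

Lemma sublinearZ (R : realType) (V : lmodType R) (q : V -> R) t x :
  sublinear q -> 0 < t -> q (t *: x) = t * q x.
Proof.
case=> _ qZ t0; apply/eqP; rewrite eq_le qZ//=.
have := qZ t^-1 (t *: x); rewrite invr_gt0 scalerA mulVf ?gt_eqF// scale1r.
by move=> /(_ t0); rewrite mulrC ler_pdivlMr// mulrC.
Qed.

Lemma sublinear_ge (R : realType) (V : lmodType R) (q : V -> R) x :
  sublinear q -> - q (- x) <= q x.
Proof.
move=> sq; rewrite lerNl -subr_ge0 opprK -(sublinear0 sq) -{1}(addNr x).
exact: sq.1.
Qed.

(** The pointwise infimum of a family of functions is sublinear as soon as the
    family as a whole is subadditive and homogeneous, members being compared with
    one another.  This covers both infima taken below: over a chain, and over the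
    translates that define a slope. *)
Lemma sublinear_inf (R : realType) (V : lmodType R) (F : set (V -> R)) :
  F !=set0 -> (forall x, has_lbound [set f x | f in F]) ->
  (forall f g, F f -> F g ->
     exists2 h, F h & forall x y, h (x + y) <= f x + g y) ->
  (forall t f, 0 < t -> F f -> exists2 g, F g & forall x, g (t *: x) <= t * f x) ->
  sublinear (fun x => inf [set f x | f in F]).
Proof.
move=> [f0 Ff0] lbF FD FZ.
have infF x : has_inf [set f x | f in F] by split => //; exists (f0 x), f0.
split=> [x y|t x t0].
  rewrite -lerBlDr; apply: lb_le_inf; first exact: (infF x).1.
  move=> _ [f Ff <-]; rewrite lerBlDr -lerBlDl.
  apply: lb_le_inf; first exact: (infF y).1.
  move=> _ [g Fg <-]; rewrite lerBlDl; have [h Fh hfg] := FD f g Ff Fg.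
  by apply: le_trans (hfg x y); apply: ge_inf => //; exists h.
rewrite mulrC -ler_pdivrMr//; apply: lb_le_inf; first exact: (infF x).1.
move=> _ [f Ff <-]; rewrite ler_pdivrMr// mulrC.
have [g Fg gf] := FZ t f t0 Ff.
by apply: le_trans (gf x); apply: ge_inf => //; exists g.
Qed.

(** The witness is [q' x = inf_(t >= 0) (q (x + t y) - t q y)].  A [q] that no
    sublinear function lies strictly below must therefore satisfy
    [q x + q y <= q (x + y)], hence be additive; and taking [x = - y] shows that
    [q'] attains [q y] on [y]. *)
Lemma sublinear_slope (R : realType) (V : lmodType R) (q : V -> R) (y : V) :
  sublinear q -> exists q' : V -> R,
    [/\ sublinear q', forall x, q' x <= q x & forall x, q' x <= q (x + y) - q y].
Proof.
move=> sq; have [qD qZ] := sq.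
pose F : set (V -> R) :=
  [set f | exists2 t, 0 <= t & f = fun x => q (x + t *: y) - t * q y].
have F0 : F q.
  by exists 0 => //; apply/funext => x; rewrite scale0r addr0 mul0r subr0.
have F1 : F (fun x => q (x + y) - q y).
  by exists 1 => //; apply/funext => x; rewrite scale1r mul1r.
have lbF x : has_lbound [set f x | f in F].
  exists (- q (- x)) => _ [_ [t t0 ->] <-].
  have [->|t_neq0] := eqVneq t 0.
    by rewrite scale0r mul0r addr0 subr0; exact: sublinear_ge.
  have {t_neq0}t0 : 0 < t by rewrite lt_def t_neq0.
  rewrite -(sublinearZ _ sq t0) lerBrDl lerBlDr.
  by have := qD (x + t *: y) (- x); rewrite addrAC subrr add0r.
exists (fun x => inf [set f x | f in F]); split.
- apply: sublinear_inf => //; first by exists q.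
  + move=> _ _ [t t0 ->] [s s0 ->].
    exists (fun x => q (x + (t + s) *: y) - (t + s) * q y).
      by exists (t + s) => //; rewrite addr_ge0.
    move=> x x'; rewrite scalerDl addrACA.
    have := qD (x + t *: y) (x' + s *: y); lra.
  + move=> a _ a0 [t t0 ->].
    exists (fun x => q (x + (a * t) *: y) - (a * t) * q y).
      by exists (a * t) => //; rewrite mulr_ge0// ltW.
    by move=> x; rewrite -scalerA -scalerDr (sublinearZ _ sq a0) mulrBr mulrA.
- by move=> x; apply: ge_inf => //; exists q.
- by move=> x; apply: ge_inf => //; eexists; [exact: F1|].
Qed.

(** Zorn's lemma applies because a chain of sublinear functions below [p] is
    bounded from below, by [- p (- x)] at [x]. *)
Lemma minimal_sublinear (R : realType) (V : lmodType R) (p : V -> R) :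
  sublinear p -> exists q : V -> R,
    [/\ sublinear q, forall x, q x <= p x &
      forall q', sublinear q' -> (forall x, q' x <= q x) -> q' = q].
Proof.
move=> sp; pose P : set (V -> R) := [set q | sublinear q /\ forall x, q x <= p x].
pose le (q1 q2 : {q | P q}) := `[< forall x, sval q2 x <= sval q1 x >].
have [|||A totA|[q [sq qp]] qmin] := @Zorn {q | P q} le.
- by move=> q; apply/asboolP.
- move=> q1 q2 q3 /asboolP h1 /asboolP h2; apply/asboolP => x.
  exact: le_trans (h2 x) (h1 x).
- move=> [q1 P1] [q2 P2] /asboolP /= h1 /asboolP /= h2.
  by apply/eq_exist/funext => x; apply/eqP; rewrite eq_le h1 h2.
- have [->|/set0P[q0 Aq0]] := eqVneq A set0.
    by exists (exist P p (conj sp (fun x => lexx _))).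
  pose F := [set sval q | q in A].
  have leF f x : F f -> - p (- x) <= f x.
    move=> [[g [sg gp]] _ <-] /=; apply: le_trans (sublinear_ge x sg).
    by rewrite lerN2.
  have lbF x : has_lbound [set f x | f in F].
    by exists (- p (- x)) => _ [f Ff <-]; exact: leF.
  have sF : sublinear (fun x => inf [set f x | f in F]).
    apply: sublinear_inf => //; first by exists (sval q0), q0.
    + move=> _ _ [f Af <-] [g Ag <-].
      have [/asboolP fg|/asboolP gf] := totA f g Af Ag.
        exists (sval g); first by exists g.
        move=> x y; have [[gD _] _] := svalP g.
        exact: le_trans (gD x y) (lerD (fg x) (lexx _)).
      exists (sval f); first by exists f.
      move=> x y; have [[fD _] _] := svalP f.
      exact: le_trans (fD x y) (lerD (lexx _) (gf y)).
    + move=> t _ t0 [f Af <-]; exists (sval f); first by exists f.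
      by move=> x; have [[_ fZ] _] := svalP f; exact: fZ.
  have infle q x : A q -> inf [set f x | f in F] <= sval q x.
    by move=> Aq; apply: ge_inf => //; exists (sval q) => //; exists q.
  have infp x : inf [set f x | f in F] <= p x.
    by apply: le_trans (infle q0 x Aq0) _; exact: (svalP q0).2.
  exists (exist P (fun x => inf [set f x | f in F]) (conj sF infp)) => q Aq.
  by apply/asboolP => x /=; exact: infle.
- exists q; split => // q' sq' q'q.
  have Pq' : P q' by split => // x; exact: le_trans (q'q x) (qp x).
  have /qmin : le (exist P q (conj sq qp)) (exist P q' Pq') by apply/asboolP.
  by case.
Qed.

(** A minimal sublinear function is linear.  Minimizing below the slope of [p]
    in the direction [v], rather than below [p], forces the value at [v]. *)
Theorem hahn_banach_point (R : realType) (V : lmodType R) (p : V -> R) (v : V) :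
  sublinear p ->
  exists f : {linear V -> R^o}, (forall x, f x <= p x) /\ f v = p v.
Proof.
move=> sp.
have [pv [spv pvp pvs]] := sublinear_slope v sp.
have [q [sq qpv qmin]] := minimal_sublinear spv.
have qp x : q x <= p x := le_trans (qpv x) (pvp x).
have qD x y : q (x + y) = q x + q y.
  apply/eqP; rewrite eq_le sq.1 /=.
  have [q' [sq' q'q q's]] := sublinear_slope y sq.
  by have := q's x; rewrite (qmin q' sq' q'q) -lerBrDr.
have qN x : q (- x) = - q x.
  by apply/eqP; rewrite -addr_eq0 -qD addNr (sublinear0 sq).
have qZ t x : q (t *: x) = t * q x.
  have [t0|t0] := ltP 0 t; first exact: sublinearZ sq t0.
  have [->|tn0] := eqVneq t 0; first by rewrite scale0r mul0r (sublinear0 sq).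
  by rewrite -[t]opprK scaleNr qN (sublinearZ _ sq) ?mulNr//
    oppr_gt0 lt_def eq_sym tn0.
have qlin : linear (q : V -> R^o) by move=> t x y; rewrite qD qZ.
pose f : {linear V -> R^o} :=
  HB.pack (q : V -> R^o) (GRing.isLinear.Build R V R^o *:%R q qlin).
exists f; split=> [//|]; apply/eqP; rewrite eq_le qp/= -lerN2 -[- f v]qN.
apply: le_trans (qpv _) _; apply: le_trans (pvs _) _.
by rewrite addNr (sublinear0 sp) sub0r.
Qed.

(** * Bounded functionals separate points *)

Definition bounded_functional (K : numFieldType) (X : normedModType K)
    (f : X -> K) : Prop :=
  exists C : K, forall x, `|f x| <= C * `|x|.

Definition separating (K : numFieldType) (X : normedModType K) : Prop :=
  forall v : X, v != 0 -> exists f : {linear X -> K^o},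
    f v != 0 /\ bounded_functional f.

Lemma separating_real (R : realType) (X : normedModType R) : separating X.
Proof.
move=> v v0; have sn : sublinear (fun x : X => `|x|).
  split=> [x y|t x t0]; first exact: ler_normD.
  by rewrite normrZ gtr0_norm.
have [f [fle fv]] := hahn_banach_point v sn.
exists f; split; first by rewrite fv normr_eq0.
exists 1 => x; rewrite mul1r ler_norml fle andbT lerNl -linearN -[leRHS]normrN.
exact: fle.
Qed.

(** A complex space with its scalars restricted to the reals; an alias, so that
    the real module structure does not compete with the complex one. *)
Definition realification (R : realType) (X : lmodType R[i]) : Type := X.

Section Realification.
Variables (R : realType) (X : lmodType R[i]).

HB.instance Definition _ := GRing.Zmodule.copy (realification X) X.

Definition real_scale (t : R) (x : realification X) : realification X :=
  (t%:C)%C *: (x : X).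

Fact real_scaleA a b v : real_scale a (real_scale b v) = real_scale (a * b) v.
Proof. by rewrite /real_scale scalerA rmorphM. Qed.

Fact real_scale1 : left_id 1 real_scale.
Proof. by move=> v; rewrite /real_scale scale1r. Qed.

Fact real_scaleDr : right_distributive real_scale +%R.
Proof. by move=> a u v; rewrite /real_scale scalerDr. Qed.

Fact real_scaleDl v : {morph real_scale^~ v : a b / a + b}.
Proof. by move=> a b; rewrite /real_scale rmorphD scalerDl. Qed.

HB.instance Definition _ := GRing.Zmodule_isLmodule.Build R (realification X)
  real_scaleA real_scale1 real_scaleDr real_scaleDl.

End Realification.

Lemma normc_le_ReIm (R : realType) (z : R[i]) :
  `|z| <= ((`|complex.Re z| + `|complex.Im z|)%:C)%C.
Proof.
have norm_real (c : R) : `|(c%:C)%C| = (`|c|%:C)%C.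
  by rewrite normc_def /= expr0n addr0 sqrtr_sqr.
have norm_i : `|'i%C : R[i]| = 1.
  by rewrite normc_def /= expr0n add0r expr1n sqrtr1.
rewrite {1}(complexE z); apply: le_trans (ler_normD _ _) _.
by rewrite normrM norm_i mul1r !norm_real rmorphD.
Qed.

(** A real functional [u] is the real part of the complex functional
    [x |-> u x - i u (i x)]. *)
Lemma separating_complex (R : realType) (X : normedModType R[i]) : separating X.
Proof.
move=> v v0; pose N (x : realification X) : R := complex.Re `|x : X|.
have NE (x : X) : ((N x)%:C)%C = `|x| by rewrite RRe_real// normr_real.
have sn : sublinear N.
  split=> [x y|t x t0].
    by rewrite -lecR rmorphD /= !NE ler_normD.
  rewrite -lecR rmorphM /= !NE normrZ ger0_norm//.
  by rewrite ler0c ltW.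
have [u [ule uv]] := hahn_banach_point (v : realification X) sn.
have uabs x : `|u x| <= N x.
  rewrite ler_norml ule andbT lerNl -linearN.
  suff -> : N x = N (- x) by exact: ule.
  by rewrite /N normrN.
pose f (x : X) : R[i]^o := (u x +i* - u ('i%C *: x))%C.
have flin : linear f.
  move=> [a b] x y.
  have E (c d : R) (z : X) : u ((c +i* d)%C *: z) = c * u z + d * u ('i%C *: z).
    have -> : (c +i* d)%C *: z = c%:C%C *: z + d%:C%C *: ('i%C *: z) :> X.
      by rewrite scalerA -scalerDl; congr (_ *: _); simpc.
    rewrite (linearD u); congr (_ + _); exact: (linearZ_LR u _ _).
  rewrite /f scalerDr !linearD /= scalerA E; simpc.
  rewrite (E (- b) a).
  have key (p q r s : R) :
    ((a * p + b * q + r) +i* (- (- b * p + a * q) - s))%C =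
    ((a * p + b * q + r) +i* (- (a * q) + b * p - s))%C.
    by congr (_ +i* _)%C; ring.
  exact: key.
pose g : {linear X -> R[i]^o} :=
  HB.pack f (GRing.isLinear.Build R[i] X (R[i]^o) *:%R f flin).
exists g; split=> /=.
  rewrite /f eq_complex negb_and /= uv; apply/orP; left.
  by apply: contra v0 => /eqP N0; rewrite -normr_eq0 -NE N0.
have uC (x : X) : (`|u x|%:C)%C <= `|x| by rewrite -NE lecR uabs.
have norm_i : `|'i%C : R[i]| = 1.
  by rewrite normc_def /= expr0n add0r expr1n sqrtr1.
exists 2 => x; apply: le_trans (normc_le_ReIm _) _; rewrite /= normrN rmorphD.
rewrite mulr_natl mulr2n; apply: lerD; first exact: uC.
by apply: le_trans (uC _) _; rewrite normrZ norm_i mul1r.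
Qed.


(** * Translations and differences of polynomials *)

Section FiniteDifferences.
Variable K : numFieldType.
Implicit Types (p q : {poly K}) (c t : K).

Definition translate c p : {poly K} := p \Po ('X + c%:P).

Fact translate_is_linear c : linear (translate c).
Proof. by move=> a p q; rewrite /translate comp_polyD comp_polyZ. Qed.

HB.instance Definition _ c :=
  GRing.isLinear.Build K {poly K} {poly K} *:%R (translate c)
    (translate_is_linear c).

Lemma translateD c d p : translate c (translate d p) = translate (c + d) p.
Proof.
by rewrite /translate -comp_polyA comp_polyD comp_polyX comp_polyC polyCD addrA.
Qed.

Lemma translate0 p : translate 0 p = p.
Proof. by rewrite /translate polyC0 addr0 comp_polyXr. Qed.

Lemma iter_translate n p : iter n (translate 1) p = translate n%:R p.
Proof.
elim: n => [|n IH]; first by rewrite translate0.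
by rewrite iterS IH translateD -natr1 addrC.
Qed.

(** Multiplying [p] by [(1 - t x)^m] changes it little when [t] is small, yet
    translating the product by [1/t] gives [p(x + 1/t) (- t x)^m], whose
    coefficients are polynomials in [t] without constant term because
    [m > deg p].  Here [A] and [B] are polynomials in [t] whose coefficients are
    polynomials in [x]; [t = 1/n] makes [p] fade under translation by [n], and
    [t = -1/n], read backwards, makes it appear. *)
Lemma translate_fade p : exists A B : {poly {poly K}},
  [/\ A.[0] = p, B.[0] = 0 & forall t, t != 0 ->
      translate t^-1 A.[t%:P] = B.[t%:P]].
Proof.
(* [size p] exceeds the degree by one, so every exponent [m - i] is positive. *)
pose m := size p.
exists (p%:P * (1 - 'X%:P * 'X) ^+ m).
exists (\sum_(i < m) (p`_i)%:P%:P * 'X^(m - i) * (1 + 'X%:P * 'X) ^+ i *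
                        (- 'X%:P) ^+ m).
split.
- by rewrite !(hornerE, horner_exp) subr0 expr1n mulr1.
- rewrite horner_sum big1// => i _.
  by rewrite !(hornerE, horner_exp) expr0n subn_eq0 leqNgt ltn_ord /= mulr0 !mul0r.
- move=> t t0; rewrite horner_sum !(hornerE, horner_exp) /translate.
  rewrite comp_polyM (rmorphXn (comp_poly _)) /= comp_polyB comp_polyM.
  rewrite comp_polyX !comp_polyC mulrDl -polyCM mulVf// [_ + 1]addrC opprD.
  rewrite addrA subrr add0r comp_polyE mulr_suml; apply: eq_bigr => i _.
  rewrite !(hornerE, horner_exp) -mulNr exprMn [(_ ^+ m) * _]mulrC mulrA.
  congr (_ * _); rewrite -mul_polyC -!mulrA; congr (_ * _).
  have -> : t%:P ^+ m = t%:P ^+ (m - i) * t%:P ^+ i.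
    by rewrite -exprD subnK// ltnW.
  rewrite mulrCA; congr (_ * _).
  rewrite -exprMn; congr (_ ^+ _).
  by rewrite mulrDl -polyCM mulVf// addrC.
Qed.

Definition difference p : {poly K} := translate 1 p - p.

Fact difference_is_linear : linear difference.
Proof.
by move=> a p q; rewrite /difference linearP scalerBr opprD addrACA.
Qed.

HB.instance Definition _ :=
  GRing.isLinear.Build K {poly K} {poly K} *:%R difference difference_is_linear.

(** The leading terms of [p(x+1)] and [p(x)] cancel. *)
Lemma size_difference p : (size (difference p) <= (size p).-1)%N.
Proof.
have s2 : size ('X + 1%:P : {poly K}) = 2 by rewrite size_XaddC.
apply/leq_sizeP => j; rewrite leq_eqVlt => /predU1P[<-|lt_j].
  have := @lead_coef_comp _ p ('X + 1%:P); rewrite s2 => /(_ isT).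
  rewrite lead_coefXaddC expr1n mulr1 /lead_coef size_comp_poly2// => E.
  by rewrite /difference /translate coefB E subrr.
rewrite /difference coefB !nth_default ?subr0// ?size_comp_poly2//.
  by move: lt_j; case: (size p).
by move: lt_j; case: (size p).
Qed.

Lemma size_iter_difference n p :
  (size (iter n difference p) <= size p - n)%N.
Proof.
elim: n => [|n IH]; first by rewrite subn0.
rewrite iterS; apply: leq_trans (size_difference _) _.
by rewrite subnS -!subn1 leq_sub2r.
Qed.

End FiniteDifferences.

(** * Geometric estimates and nuclear operators *)

Definition archimedean (K : numFieldType) : Prop :=
  forall x : K, exists n : nat, `|x| <= n%:R.

Lemma geometric_small (K : numFieldType) (C e : K) :
  archimedean K -> 0 <= C -> 0 < e -> exists n : nat, C * 2^-1 ^+ n < e.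
Proof.
move=> aK C0 e0; have [n nC] := aK (C / e); exists n.
rewrite exprVn ltr_pdivrMr ?exprn_gt0// mulrC -ltr_pdivrMr//.
have {}nC : C / e <= n%:R by rewrite -[C / e]ger0_norm// divr_ge0// ltW.
by apply: le_lt_trans nC _; rewrite -natrX ltr_nat ltn_expl.
Qed.

Lemma geometric_eq0 (K : numFieldType) (X : normedModType K) (C : K) (x : X) :
  archimedean K -> (forall k : nat, `|x| <= C * 2^-1 ^+ k) -> x = 0.
Proof.
move=> aK xC; apply/eqP/negPn/negP => x0.
have C0 : 0 <= C by have := le_trans (normr_ge0 _) (xC 0%N); rewrite expr0 mulr1.
have : 0 < `|x| by rewrite normr_gt0.
by move=> /(geometric_small aK C0)[n] /lt_geF; rewrite xC.
Qed.

Lemma geometric_tail (K : numFieldType) (X : normedModType K) (u : nat -> X)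
    (C : K) (k : nat) :
  (forall j, (k <= j)%N -> `|u j.+1 - u j| <= C * 2^-1 ^+ j) ->
  forall n, (k <= n)%N -> `|u n - u k| <= C * 2 * 2^-1 ^+ k.
Proof.
move=> uC n kn.
have C0 : 0 <= C * 2^-1 ^+ k by apply: le_trans (uC k _).
suff : `|u n - u k| <= C * 2 * 2^-1 ^+ k - C * 2 * 2^-1 ^+ n.
  move=> /le_trans; apply; rewrite gerBl.
  rewrite -(subnK kn) exprD mulrCA mulr_ge0 ?exprn_ge0 ?invr_ge0//.
  by rewrite mulrAC mulr_ge0.
elim: n kn => [|n IH]; first by rewrite leqn0 => /eqP ->; rewrite !subrr normr0.
rewrite leq_eqVlt => /predU1P[->|]; first by rewrite !subrr normr0.
rewrite ltnS => kn.
have -> : u n.+1 - u k = (u n.+1 - u n) + (u n - u k) by rewrite addrA subrK.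
apply: le_trans (ler_normD _ _) _; apply: le_trans (lerD (uC n kn) (IH kn)) _.
by rewrite exprS le_eqVlt; apply/orP; left; apply/eqP; field.
Qed.

(** Completeness gives the limit from one bound [C]; a later and sharper bound
    [D] on the increments then controls the distance from the [k]-th term.  The
    limit is quantified first, so that [k] and [D] can be varied at will. *)
Lemma geometric_limit (K : numFieldType) (X : completeNormedModType K)
    (u : nat -> X) (C : K) :
  archimedean K -> (forall j, `|u j.+1 - u j| <= C * 2^-1 ^+ j) ->
  exists l : X, forall k D,
    (forall j, (k <= j)%N -> `|u j.+1 - u j| <= D * 2^-1 ^+ j) ->
    `|l - u k| <= D * 2 * 2^-1 ^+ k.
Proof.
move=> aK uC.
have C0 : 0 <= C by have := le_trans (normr_ge0 _) (uC 0%N); rewrite expr0 mulr1.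
have /cauchy_cvg ucvg : cauchy (u @ \oo).
  apply/cauchy_exP => e e0.
  have [n nC] := geometric_small aK (mulr_ge0 C0 (ler0n K 2)) e0.
  exists (u n); exists n => // m /= nm; rewrite -ball_normE /= distrC.
  by apply: le_lt_trans nC; apply: geometric_tail nm => j _; exact: uC.
exists (lim (u @ \oo)) => k D uD; apply/ler_addgt0Pr => e e0.
have [N _ Nl] := (@cvgrPdist_lt _ _ _ _ _ _ _).1 ucvg e e0.
have := Nl (maxn N k) (leq_maxl _ _) => /= lN.
have -> : lim (u @ \oo) - u k =
    (u (maxn N k) - u k) + (lim (u @ \oo) - u (maxn N k)).
  by rewrite [RHS]addrC addrA subrK.
apply: le_trans (ler_normD _ _) _; apply: lerD (ltW lN).
exact: geometric_tail (leq_maxr _ _).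
Qed.

(** The operator [x |-> \sum_j g_j(x) h_j], an absolutely convergent sum of
    rank-one operators. *)
Lemma nuclear_operator (K : numFieldType) (X : completeNormedModType K)
    (g : nat -> {linear X -> K^o}) (h : nat -> X) :
  archimedean K ->
  (forall j x, `|g j x : K| * `|h j| <= `|x| * 2^-1 ^+ j) ->
  exists S : {linear X -> X}, (forall x, `|S x| <= 2 * `|x|) /\
    forall x N, (forall j, (N <= j)%N -> g j x = 0) ->
      S x = \sum_(j < N) (g j x : K) *: h j.
Proof.
move=> aK gh; pose u x n := \sum_(j < n) (g j x : K) *: h j.
have uS x j : u x j.+1 - u x j = (g j x : K) *: h j.
  by rewrite /u big_ord_recr /= addrAC subrr add0r.
have uC x j : `|u x j.+1 - u x j| <= `|x| * 2^-1 ^+ j by rewrite uS normrZ.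
have /(_ _)/cid-/all_sig[S Sl] := fun x => geometric_limit aK (uC x).
have SC x k : `|S x - u x k| <= `|x| * 2 * 2^-1 ^+ k by apply: Sl => j _.
have Slin : linear S.
  move=> a x y; apply/eqP; rewrite -subr_eq0; apply/eqP.
  pose C := `|a *: x + y| * 2 + `|a| * (`|x| * 2) + `|y| * 2.
  apply: (geometric_eq0 (C := C) aK) => k; rewrite {}/C.
  have -> : S (a *: x + y) - (a *: S x + S y) =
    (S (a *: x + y) - u (a *: x + y) k) - (a *: (S x - u x k) + (S y - u y k)).
    have -> : u (a *: x + y) k = a *: u x k + u y k.
      rewrite /u scaler_sumr -big_split; apply: eq_bigr => j _ /=.
      by rewrite linearP scalerDl scalerA.
    by rewrite scalerBr addrACA -opprD opprB addrA subrK.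
  apply: le_trans (ler_normB _ _) _; rewrite !mulrDl -addrA; apply: lerD => //.
  apply: le_trans (ler_normD _ _) _; apply: lerD => //.
  by rewrite normrZ -!mulrA ler_wpM2l// mulrA.
pose T : {linear X -> X} := HB.pack S (GRing.isLinear.Build K X X *:%R S Slin).
exists T; split=> [x|x N gN].
  by have := SC x 0%N; rewrite /u big_ord0 subr0 expr0 mulr1 mulrC.
apply/eqP; rewrite -subr_eq0 -normr_le0.
have := Sl x N 0; rewrite !mul0r; apply => j Nj.
by rewrite uS gN// scale0r normr0 mul0r.
Qed.

(** * Biorthogonal sequences and backward chains *)

Lemma bounded_functionalW (K : numFieldType) (X : normedModType K) (f : X -> K) :
  bounded_functional f ->
  exists2 C : K, 0 <= C & forall x, `|f x| <= C * `|x|.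
Proof.
move=> [C fC]; exists `|C| => // x.
by rewrite -[X in _ * X]normr_id -normrM ger0_norm// (le_trans _ (fC x)).
Qed.

Lemma bounded_functionalD (K : numFieldType) (X : normedModType K)
    (a : K) (f g : X -> K) :
  bounded_functional f -> bounded_functional g ->
  bounded_functional (fun x => f x + a * g x).
Proof.
move=> [C fC] [D gD]; exists (C + `|a| * D) => x.
apply: le_trans (ler_normD _ _) _; rewrite mulrDl; apply: lerD => //.
by rewrite normrM -mulrA ler_wpM2l.
Qed.

Lemma bounded_functionalZ (K : numFieldType) (X : normedModType K)
    (a : K) (f : X -> K) :
  bounded_functional f -> bounded_functional (fun x => a * f x).
Proof.
by move=> [C fC]; exists (`|a| * C) => x; rewrite normrM -mulrA ler_wpM2l.
Qed.

Lemma bounded_functional_sum (K : numFieldType) (X : normedModType K)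
    (n : nat) (a : nat -> K) (f : nat -> X -> K) :
  (forall i, (i < n)%N -> bounded_functional (f i)) ->
  bounded_functional (fun x => \sum_(i < n) a i * f i x).
Proof.
elim: n => [|n IH] fb; first by exists 0 => x; rewrite big_ord0 normr0 mul0r.
have -> : (fun x => \sum_(i < n.+1) a i * f i x) =
          (fun x => (\sum_(i < n) a i * f i x) + a n * f n x).
  by apply/funext => x; rewrite big_ord_recr.
by apply: bounded_functionalD; [apply: IH => i i_n|]; apply: fb => //; exact: ltnW.
Qed.

Definition biorthogonal (K : numFieldType) (X : normedModType K)
    (n : nat) (s : nat -> X * {linear X -> K^o}) : Prop :=
  (forall i, (i < n)%N -> bounded_functional (s i).2) /\
  (forall i j, (i < n)%N -> (j < n)%N -> (s i).2 (s j).1 = (i == j)%:R :> K).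

(** Since [X] is not spanned by the vectors at hand, subtracting from a suitable
    [x] its components along them leaves a nonzero [v] killed by all the
    functionals at hand.  A functional [g] with [g v != 0], corrected by those
    functionals and normalized, then completes the system. *)
Lemma biorthogonal_extend (K : numFieldType) (X : normedModType K) (n : nat)
    (s : nat -> X * {linear X -> K^o}) :
  separating X -> infinite_dimensional X -> biorthogonal n s ->
  exists a, biorthogonal n.+1 (fun i => if (i < n)%N then s i else a).
Proof.
move=> sepX infX [sb sd].
have [x xn] : exists x, x != \sum_(i < n) ((s i).2 x : K) *: (s i).1.
  apply: contrapT => xn; apply: infX; exists n, (fun i => (s i).1) => x.
  exists (fun i => (s i).2 x : K); apply/eqP/negPn/negP => xE; apply: xn.
  by exists x.
pose v := x - \sum_(i < n) ((s i).2 x : K) *: (s i).1.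
have v0 : v != 0 by rewrite subr_eq0.
have sv j : (j < n)%N -> (s j).2 v = 0 :> K.
  move=> jn; rewrite linearB linear_sum (bigD1 (Ordinal jn))//= big1 => [|i ij].
    by rewrite addr0 linearZ /= sd// eqxx /GRing.scale /= mulr1 subrr.
  rewrite linearZ /= sd//; case: eqP => [ji|_]; last by rewrite scaler0.
  by move: ij; rewrite -val_eqE /= ji eqxx.
have [g [gv gb]] := sepX v v0.
pose f (x : X) : K^o :=
  (g v : K)^-1 * ((g x : K) - \sum_(i < n) (g (s i).1 : K) * ((s i).2 x : K)).
have flin : linear f.
  move=> a y z; rewrite /f linearP.
  under eq_bigr => i _ do rewrite linearP mulrDr /GRing.scale /= mulrCA.
  rewrite big_split /= -mulr_sumr /GRing.scale /=.
  ring.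
pose F : {linear X -> K^o} := HB.pack f (GRing.isLinear.Build K X K^o *:%R f flin).
exists (v, F); split.
  move=> i _; case: ifP => [/sb//|_]; rewrite /F /=.
  apply: bounded_functionalZ.
  have := bounded_functionalD (-1) gb
    (bounded_functional_sum (fun i => g (s i).1 : K) sb).
  by congr bounded_functional; apply/funext => x'; rewrite mulN1r.
move=> i j; rewrite !ltnS => ni nj.
case: ifP => iln; case: ifP => jln /=.
- exact: sd.
- rewrite sv//.
  have -> : j = n by apply/eqP; rewrite eqn_leq nj leqNgt jln.
  by rewrite ltn_eqF.
- have -> : i = n by apply/eqP; rewrite eqn_leq ni leqNgt iln.
  rewrite gtn_eqF// /f (bigD1 (Ordinal jln))//= big1 => [|k kj].
    by rewrite addr0 sd// eqxx mulr1 subrr mulr0.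
  rewrite sd//; case: eqP => [ji|_]; last by rewrite mulr0.
  by move: kj; rewrite -val_eqE /= ji eqxx.
- have -> : i = n by apply/eqP; rewrite eqn_leq ni leqNgt iln.
  have -> : j = n by apply/eqP; rewrite eqn_leq nj leqNgt jln.
  rewrite eqxx /f big1 => [|k _]; last by rewrite sv// mulr0.
  by rewrite subr0 mulVf.
Qed.

Lemma biorthogonal_sequence (K : numFieldType) (X : normedModType K) :
  separating X -> infinite_dimensional X ->
  exists s : nat -> X * {linear X -> K^o}, forall n, biorthogonal n s.
Proof.
move=> sepX infX.
pose A : Type := (X * {linear X -> K^o})%type.
have step (n : nat) (s : nat -> A) : {a : A | biorthogonal n s ->
    biorthogonal n.+1 (fun i => if (i < n)%N then s i else a)}.
  apply: cid; have [sn|?] := pselect (biorthogonal n s).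
    have [a aP] := biorthogonal_extend sepX infX sn.
    by exists a.
  by exists (s 0%N).
pose st := fix st n : nat -> A := if n is n'.+1 then
  (fun i => if (i < n')%N then st n' i else sval (step n' (st n')))
  else fun=> (0, (\0 : {linear X -> K^o})).
have stP n : biorthogonal n (st n).
  elim: n => [|n IH]; first by split.
  exact: svalP (step n (st n)) IH.
have stE n i : (i < n)%N -> st n i = st i.+1 i.
  elim: n => // n IH; rewrite ltnS leq_eqVlt => /predU1P[->//|i_n].
  by rewrite [LHS]/= i_n IH.
exists (fun i => st i.+1 i) => n; have [sb sd] := stP n; split=> [i i_n|i j i_n j_n].
  by rewrite -(stE n)//; exact: sb.
by rewrite -(stE n)// -(stE n j)//; exact: sd.
Qed.

(** [T - 1] shifts the sequence [h] backwards and kills its first term, as the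
    difference operator does to the binomial polynomials. *)
Definition backward_chain (K : numFieldType) (X : normedModType K)
    (T : {linear X -> X}) (h : nat -> X) : Prop :=
  T (h 0%N) = h 0%N /\ forall j, T (h j.+1) = h j.+1 + h j.

(** The functional [f], which comes from the first pair of the biorthogonal
    sequence, is there to show that the closed span of the chain is not the whole
    space. *)
Lemma exists_backward_chain (K : numFieldType) (X : completeNormedModType K) :
  archimedean K -> separating X -> infinite_dimensional X ->
  exists (T : {linear X -> X}) (h : nat -> X) (f : {linear X -> K^o}),
    [/\ forall x, `|T x| <= 3 * `|x|, backward_chain T h, h 0%N != 0 &
      [/\ bounded_functional f, forall j, f (h j) = 0 & exists x, f x != 0]].
Proof.
move=> aK sepX infX; have [s sP] := biorthogonal_sequence sepX infX.
pose e i := (s i).1; pose f i := (s i).2.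
have fb i : bounded_functional (f i) by apply: (sP i.+1).1.
have fe i j : f i (e j) = (i == j)%:R :> K.
  by apply: (sP (maxn i j).+1).2; rewrite ltnS ?leq_maxl ?leq_maxr.
have /(_ _)/cid2-/all_sig2[C C0 fC] := fun i => bounded_functionalW (fb i).
(* [b j / b j.+1 = 1 / w j] is the weight of the shift [e j.+2 |-> e j.+1]; its
   smallness pays for the norms of the functional [f j.+2] and of [e j.+1], and
   leaves a factor [2^-j]. *)
pose w j : K := (1 + `|e j.+1|) * (1 + C j.+2) * 2 ^+ j.
have w0 j : 0 < w j by rewrite !mulr_gt0 ?exprn_gt0// ltr_pwDl.
pose b n := \prod_(j < n) w j.
have b0 n : 0 < b n by apply: prodr_gt0.
have bS n : b n.+1 = b n * w n by rewrite /b big_ord_recr.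
pose h j := b j *: e j.+1.
pose g0 j (x : X) : K^o := (b j.+1)^-1 * (f j.+2 x : K).
have g0lin j : linear (g0 j).
  by move=> a x y; rewrite /g0 linearP mulrDr /GRing.scale /= mulrCA.
pose g j : {linear X -> K^o} :=
  HB.pack (g0 j) (GRing.isLinear.Build K X K^o *:%R (g0 j) (g0lin j)).
have gh j x : `|g j x : K| * `|h j| <= `|x| * 2^-1 ^+ j.
  rewrite /g /= /g0 /h normrM normrZ normfV !(gtr0_norm (b0 _)) bS.
  rewrite (_ : (b j * w j)^-1 * `|f j.+2 x| * (b j * `|e j.+1|) =
     `|f j.+2 x| / (1 + C j.+2) * (`|e j.+1| / (1 + `|e j.+1|)) * 2^-1 ^+ j).
    rewrite ler_wpM2r ?exprn_ge0 ?invr_ge0//.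
    rewrite -[leRHS]mulr1; apply: ler_pM; rewrite ?divr_ge0 ?addr_ge0//.
      rewrite ler_pdivrMr ?ltr_pwDl//; apply: le_trans (fC _ _) _.
      by rewrite mulrC ler_wpM2l// lerDr.
    by rewrite ler_pdivrMr ?ltr_pwDl// mul1r lerDr.
  rewrite /w exprVn; field.
  by rewrite expf_neq0 ?gt_eqF// ?ltr_pwDl.
have [S [S2 SE]] := nuclear_operator aK gh.
have ghE i j : g j (h i) = (i == j.+1)%:R * (b j.+1)^-1 * b i :> K.
  rewrite /g /= /g0 /h linearZ /= fe /GRing.scale /=.
  by rewrite eqSS [j.+1 == i]eq_sym mulrA mulrC mulrA.
clearbody g.
pose T : {linear X -> X} := idfun \+ S.
exists T, h, (f 0%N); split.
- move=> x; rewrite /T /=; apply: le_trans (ler_normD _ _) _.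
  rewrite (_ : 3 * `|x| = `|x| + 2 * `|x|); last by ring.
  exact: lerD.
- split.
    by rewrite /T /= (SE _ 0%N) ?big_ord0 ?addr0// => j _; rewrite ghE !mul0r.
  move=> j; rewrite /T /= (SE _ j.+1).
    rewrite big_ord_recr big1 /= ?add0r => [|i _].
      rewrite ghE eqxx mul1r mulVf ?gt_eqF// scale1r//.
    by rewrite ghE eqSS gtn_eqF// !mul0r scale0r.
  by move=> i ji; rewrite ghE eqSS ltn_eqF// !mul0r.
- rewrite /h /b big_ord0 scale1r; apply/eqP => e1.
  have := fe 1%N 1%N; rewrite e1 linear0 => /eqP; by rewrite eq_sym oner_eq0.
- split=> // [j|]; first by rewrite /h linearZ /= fe scaler0.
  by exists (e 0%N); rewrite fe oner_neq0.
Qed.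

(** * Translation transported to the space *)

Section NewtonMap.
Variables (K : numFieldType) (X : lmodType K) (h : nat -> X).
Implicit Types p q : {poly K}.

Fact iter_difference_is_linear n : linear (iter n (@difference K)).
Proof. by elim: n => [//|n IH] a p q; rewrite !iterS IH linearP. Qed.

HB.instance Definition _ n :=
  GRing.isLinear.Build K {poly K} {poly K} *:%R (iter n (@difference K))
    (iter_difference_is_linear n).

(** Newton's forward difference formula: the coordinates of [p] in the basis of
    binomial polynomials are the iterated differences of [p] at [0]. *)
Definition newton p : X := \sum_(j < size p) (iter j (@difference K) p).[0] *: h j.

Lemma newton_widen N p : (size p <= N)%N ->
  newton p = \sum_(j < N) (iter j (@difference K) p).[0] *: h j.
Proof.
move=> pN; rewrite /newton.
rewrite (big_ord_widen _ (fun j => (iter j (@difference K) p).[0] *: h j) pN).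
rewrite big_mkcond; apply: eq_bigr => j _; case: ltnP => // pj.
have := size_iter_difference j p; rewrite (eqP pj) leqn0 size_poly_eq0.
by move=> /eqP->; rewrite horner0 scale0r.
Qed.

Fact newton_is_linear : linear newton.
Proof.
move=> a p q; pose N := maxn (size (a *: p + q)) (maxn (size p) (size q)).
rewrite !(newton_widen (N := N)) ?leq_maxl// /N ?leq_max ?leqnn ?orbT//.
rewrite scaler_sumr -big_split; apply: eq_bigr => j _ /=.
by rewrite linearP hornerD hornerZ scalerDl scalerA.
Qed.

HB.instance Definition _ :=
  GRing.isLinear.Build K {poly K} X *:%R newton newton_is_linear.

Lemma newton1 : newton 1 = h 0%N.
Proof. by rewrite /newton size_poly1 big_ord1 /= hornerC scale1r. Qed.

End NewtonMap.

Lemma newton_translate (K : numFieldType) (X : normedModType K)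
    (T : {linear X -> X}) (h : nat -> X) (p : {poly K}) :
  backward_chain T h -> T (newton h p) = newton h (translate 1 p).
Proof.
move=> [h0 hS]; have -> : translate 1 p = p + difference p.
  by rewrite /difference addrC subrK.
rewrite linearD /=.
rewrite (newton_widen h (leqnSn (size p))).
have pd : (size (difference p) <= size p)%N.
  exact: leq_trans (size_difference p) (leq_pred _).
rewrite (newton_widen h pd) linear_sum !big_ord_recl /= linearZ /= h0 -addrA.
congr (_ + _); rewrite -big_split; apply: eq_bigr => j _ /=.
by rewrite linearZ /= hS scalerDr -iterS iterSr.
Qed.

Lemma newton_iter (K : numFieldType) (X : normedModType K)
    (T : {linear X -> X}) (h : nat -> X) (n : nat) (p : {poly K}) :
  backward_chain T h -> iter n T (newton h p) = newton h (translate n%:R p).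
Proof.
move=> Th; rewrite -iter_translate; elim: n => // n IH.
by rewrite !iterS IH newton_translate.
Qed.

Lemma bounded_specialization (K : numFieldType) (X : normedModType K)
    (L : {linear {poly K} -> X}) (A : {poly {poly K}}) :
  exists2 C : K, 0 <= C & forall t : K, `|t| <= 1 -> `|L A.[t%:P]| <= C.
Proof.
elim/poly_ind: A => [|A c [C C0 AC]].
  by exists 0 => // t _; rewrite horner0 linear0 normr0.
exists (C + `|L c|) => [|t t1]; first by rewrite addr_ge0.
rewrite hornerMXaddC mulrC mul_polyC linearD linearZ /=.
apply: le_trans (ler_normD _ _) _; rewrite lerD2r normrZ.
by apply: le_trans (ler_piMl _ t1) _ => //; exact: AC.
Qed.

(** Polynomial dependence on [t] survives every linear map, continuous or not,
    since only finitely many vectors are involved. *)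
Lemma lipschitz_specialization (K : numFieldType) (X : normedModType K)
    (L : {linear {poly K} -> X}) (A : {poly {poly K}}) :
  exists2 C : K, 0 <= C &
    forall t : K, `|t| <= 1 -> `|L A.[t%:P] - L A.[0]| <= C * `|t|.
Proof.
elim/poly_ind: A => [|A c _].
  by exists 0 => // t _; rewrite !horner0 subrr normr0 mul0r.
have [C C0 AC] := bounded_specialization L A.
exists C => // t t1; rewrite !hornerMXaddC mulr0 add0r linearD addrK.
by rewrite mulrC mul_polyC linearZ normrZ mulrC ler_wpM2r// AC.
Qed.

(** With [t = 1/(n+1)], the polynomial [r] is the sum of a copy of [p] about to
    fade and of a copy of [q] about to appear. *)
Lemma newton_transitive (K : numFieldType) (X : normedModType K)
    (T : {linear X -> X}) (h : nat -> X) (p q : {poly K}) (e : K) :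
  archimedean K -> backward_chain T h -> 0 < e ->
  exists (n : nat) (r : {poly K}),
    `|newton h r - newton h p| <= e /\ `|iter n T (newton h r) - newton h q| <= e.
Proof.
move=> aK Th e0.
have [A [B [A0 B0 AB]]] := translate_fade p.
have [A' [B' [A'0 B'0 AB']]] := translate_fade q.
have [C1 C10 hA] := lipschitz_specialization (newton h) A.
have [C2 C20 hB] := lipschitz_specialization (newton h) B.
have [C3 C30 hA'] := lipschitz_specialization (newton h) A'.
have [C4 C40 hB'] := lipschitz_specialization (newton h) B'.
pose C := C1 + C2 + C3 + C4.
have C0 : 0 <= C by rewrite !addr_ge0.
have [n nC] := aK (C / e).
have {}nC : C * n.+1%:R^-1 <= e.
  rewrite ler_pdivrMr ?ltr0n// mulrC -ler_pdivrMr//.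
  apply: le_trans (_ : n%:R <= _); last by rewrite ler_nat.
  by rewrite -[C / e]ger0_norm// divr_ge0// ltW.
pose t : K := n.+1%:R^-1.
have t_neq0 : t != 0 by rewrite invr_eq0 pnatr_eq0.
have tE : `|t| = t by rewrite ger0_norm// invr_ge0.
have t1 : `|t| <= 1 by rewrite tE invf_le1 ?ltr0n// ler1n.
have nt1 : `|- t| <= 1 by rewrite normrN.
have small D1 D2 x y : 0 <= C - (D1 + D2) ->
    `|x| <= D1 * t -> `|y| <= D2 * t -> `|x + y : X| <= e.
  rewrite subr_ge0 => DC xD yD; apply: le_trans nC.
  apply: le_trans (ler_normD _ _) _; apply: le_trans (lerD xD yD) _.
  by rewrite -mulrDl ler_wpM2r// invr_ge0.
exists n.+1, (A.[t%:P] + B'.[(- t)%:P]); split.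
  rewrite linearD addrAC; apply: (small C1 C4).
  - by rewrite /C (_ : _ - _ = C2 + C3) ?addr_ge0//; ring.
  - by have := hA t t1; rewrite A0 tE.
  - by have := hB' (- t) nt1; rewrite B'0 linear0 subr0 normrN tE.
rewrite newton_iter// linearD /=.
have -> : translate n.+1%:R A.[t%:P] = B.[t%:P] by rewrite -AB// invrK.
have -> : translate n.+1%:R B'.[(- t)%:P] = A'.[(- t)%:P].
  rewrite -AB' ?oppr_eq0// translateD invrN invrK subrr.
  exact: translate0.
rewrite linearD -addrA; apply: (small C2 C3).
- by rewrite /C (_ : _ - _ = C1 + C4) ?addr_ge0//; ring.
- by have := hB t t1; rewrite B0 linear0 subr0 tE.
- by have := hA' (- t) nt1; rewrite A'0 normrN tE.
Qed.

(** * Hypercyclic vectors *)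

Definition countably_dense (K : numFieldType) : Prop :=
  exists d : nat -> K, forall (z e : K), 0 < e -> exists n, `|z - d n| <= e.

Lemma injective_nat_unbounded (f : nat -> nat) (N : nat) :
  injective f -> exists j, (N <= f j)%N.
Proof.
move=> fI; apply: contrapT => fN.
have fltN j : (f j < N)%N by rewrite ltnNge; apply/negP => Nj; apply: fN; exists j.
pose g (i : 'I_N.+1) := Ordinal (fltN i).
have /leq_card : injective g by move=> i j [/fI /val_inj].
by rewrite !card_ord ltnn.
Qed.

(** Each approximation has to recur at arbitrarily late positions, since the
    orbit of the vector built below follows the [k]-th polynomial with a
    precision that depends on [k].  Pairing the list of coefficients with a dummy
    natural number achieves this. *)
Lemma dense_polynomials (K : numFieldType) (X : normedModType K)
    (L : {linear {poly K} -> X}) :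
  countably_dense K -> exists q : nat -> {poly K}, forall p (e : K) N, 0 < e ->
    exists2 k, (N <= k)%N & `|L p - L (q k)| <= e.
Proof.
move=> [d dP].
exists (fun k => if (unpickle k : option (nat * seq nat)) is Some (_, s)
                 then Poly (map d s) else 0).
move=> p e N e0.
pose B := 1 + \sum_(i < size p) `|L 'X^i|.
have B0 : 0 < B by rewrite ltr_pwDl// sumr_ge0.
have /(_ _)/cid-/all_sig[c cP] := fun i => dP p`_i (e / B) (divr_gt0 e0 B0).
pose s := mkseq c (size p).
have [|j jN] := @injective_nat_unbounded (fun j => pickle (j, s)) N.
  by move=> i j /(pcan_inj pickleK)[].
exists (pickle (j, s)) => //; rewrite pickleK.
have -> : L p - L (Poly [seq d i | i <- s]) =
    \sum_(i < size p) (p`_i - d (c i)) *: L 'X^i.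
  rewrite -linearB -[p in LHS]coefK poly_def.
  have -> : Poly [seq d i | i <- s] = \poly_(i < size p) d (c i).
    apply/polyP => i; rewrite coef_Poly coef_poly; case: ltnP => ip.
      by rewrite (nth_map 0%N) ?size_mkseq// nth_mkseq.
    by rewrite nth_default// size_map size_mkseq.
  rewrite poly_def -sumrB linear_sum; apply: eq_bigr => i _.
  by rewrite -scalerBl linearZ.
apply: le_trans (ler_norm_sum _ _ _) _.
apply: le_trans (_ : e / B * \sum_(i < size p) `|L 'X^i| <= _).
  rewrite mulr_sumr; apply: ler_sum => i _; rewrite normrZ ler_wpM2r//.
rewrite mulrAC ler_pdivrMr//; apply: ler_wpM2l; first exact: ltW.
by rewrite /B lerDr.
Qed.

Lemma iter_linearB (K : numFieldType) (X : lmodType K) (T : {linear X -> X}) n x y :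
  iter n T (x - y) = iter n T x - iter n T y.
Proof. by elim: n => // n IH; rewrite !iterS IH linearB. Qed.

Lemma iter_norm (K : numFieldType) (X : normedModType K) (T : {linear X -> X})
    (D : K) n x :
  0 <= D -> (forall y, `|T y| <= D * `|y|) -> `|iter n T x| <= D ^+ n * `|x|.
Proof.
move=> D0 TD; elim: n => [|n IH]; first by rewrite expr0 mul1r.
rewrite iterS exprS -mulrA; apply: le_trans (TD _) _; exact: ler_wpM2l.
Qed.

(** The vector is the limit of [newton h p_k], where [p_(k+1)] is close to [p_k]
    and [T^(n_k)] sends its image near that of [q k].  The step from [p_k] to
    [p_(k+1)] has size at most [2^-k D^-(n_0 + ... + n_(k-1))], so that no
    [T^(n_i)] with [i < k] enlarges it beyond [2^-k]. *)
Lemma exists_hypercyclic_vector (K : numFieldType) (X : completeNormedModType K)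
    (T : {linear X -> X}) (h : nat -> X) (D : K) (q : nat -> {poly K}) :
  archimedean K -> backward_chain T h ->
  1 <= D -> (forall x, `|T x| <= D * `|x|) ->
  exists x : X,
    (forall n e, 0 < e -> exists p, `|iter n T x - newton h p| <= e) /\
    (forall k, exists n, `|iter n T x - newton h (q k)| <= 2 * 2^-1 ^+ k).
Proof.
move=> aK Th D1 TD.
have D0 : 0 < D by apply: lt_le_trans D1.
have e0 k N : 0 < 2^-1 ^+ k * D^-1 ^+ N.
  by rewrite mulr_gt0// exprn_gt0 ?invr_gt0.
have DV0 : 0 <= D^-1 by rewrite invr_ge0 ltW.
have DN N : D^-1 ^+ N <= 1 by apply: exprn_ile1; rewrite // invf_le1.
have step k (s : {poly K} * nat) : {nr : nat * {poly K} |
    `|newton h nr.2 - newton h s.1| <= 2^-1 ^+ k * D^-1 ^+ s.2 /\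
    `|iter nr.1 T (newton h nr.2) - newton h (q k)| <= 2^-1 ^+ k * D^-1 ^+ s.2}.
  apply: cid; have [n [r nr]] := newton_transitive s.1 (q k) aK Th (e0 k s.2).
  by exists (n, r).
(* The state is the current polynomial and the sum of the times chosen so far. *)
pose st := fix st k : {poly K} * nat := if k is k'.+1 then
  let nr := sval (step k' (st k')) in (nr.2, ((st k').2 + nr.1)%N) else (0, 0%N).
pose u k := newton h (st k).1.
pose n k := (sval (step k (st k))).1.
have uS k : `|u k.+1 - u k| <= 2^-1 ^+ k * D^-1 ^+ (st k).2.
  exact: (svalP (step k (st k))).1.
have uq k : `|iter (n k) T (u k.+1) - newton h (q k)| <= 2^-1 ^+ k.
  apply: le_trans (svalP (step k (st k))).2 _.
  by rewrite ler_piMr// exprn_ge0// invr_ge0.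
have stS k : (st k.+1).2 = ((st k).2 + n k)%N by [].
have uS1 k j : (k <= j)%N -> `|u j.+1 - u j| <= D^-1 ^+ (st k).2 * 2^-1 ^+ j.
  move=> kj; apply: le_trans (uS j) _; rewrite mulrC.
  rewrite ler_wpM2r ?exprn_ge0 ?invr_ge0// -(subnK kj).
  elim: (j - k)%N => [//|i IH]; rewrite addSn stS exprD.
  apply: le_trans IH; by rewrite ler_piMr// exprn_ge0.
have [|l lP] := geometric_limit (u := u) (C := 1) aK.
  by move=> j; apply: le_trans (uS j) _; rewrite mul1r ler_piMr//
    exprn_ge0 ?invr_ge0.
have lu k : `|l - u k| <= D^-1 ^+ (st k).2 * 2 * 2^-1 ^+ k.
  by apply: lP => j; exact: uS1.
have iterD m x : `|iter m T x| <= D ^+ m * `|x| := iter_norm m x (ltW D0) TD.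
exists l; split=> [m e e_gt0|k].
  have [k ke] := geometric_small (C := D ^+ m * 2) aK
    (mulr_ge0 (exprn_ge0 m (ltW D0)) (ler0n _ _)) e_gt0.
  exists (translate m%:R (st k).1); rewrite -(newton_iter m _ Th) -iter_linearB.
  apply: le_trans (ltW ke); apply: le_trans (iterD _ _) _.
  rewrite -mulrA ler_wpM2l ?exprn_ge0 ?(ltW D0)//; apply: le_trans (lu k) _.
  by rewrite -mulrA ler_piMl// mulr_ge0// exprn_ge0// invr_ge0.
exists (n k).
have -> : iter (n k) T l - newton h (q k) =
    iter (n k) T (l - u k.+1) + (iter (n k) T (u k.+1) - newton h (q k)).
  by rewrite iter_linearB addrA subrK.
apply: le_trans (ler_normD _ _) _; rewrite mulr_natl mulr2n; apply: lerD => //.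
apply: le_trans (iterD _ _) _.
apply: le_trans (ler_wpM2l (exprn_ge0 _ (ltW D0)) (lu k.+1)) _.
rewrite stS exprD exprS.
rewrite [leLHS](_ : _ = D^-1 ^+ (st k).2 * (D^-1 ^+ n k * D ^+ n k) * 2^-1 ^+ k).
  rewrite -exprMn mulVf ?gt_eqF// expr1n mulr1.
  by rewrite ler_piMl// exprn_ge0// invr_ge0.
by field.
Qed.

Lemma closure_normP (K : numFieldType) (X : normedModType K) (A : set X) (x : X) :
  closure A x <-> forall e : K, 0 < e -> exists2 y, A y & `|x - y| <= e.
Proof.
split=> [Ax e e0|Ax B /nbhs_ballP[e /= e0 eB]].
  have [y [Ay]] := Ax _ (nbhsx_ballx x e e0).
  by rewrite -ball_normE /= => /ltW xy; exists y.
have [y Ay xy] := Ax (e / 2) (divr_gt0 e0 (ltr0n _ 2)).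
exists y; split=> //; apply: eB; rewrite -ball_normE /=.
apply: le_lt_trans xy _; rewrite ltr_pdivrMr// ltr_pMr// ltr1n//.
Qed.

Theorem subspace_hypercyclic_operator (K : numFieldType)
    (X : completeNormedModType K) :
  archimedean K -> countably_dense K -> separating X ->
  infinite_dimensional X ->
  exists T : {linear X -> X}, bounded_operator T /\ subspace_hypercyclic T.
Proof.
move=> aK dK sepX infX.
have [T [h [f [T3 Th h0 [fb fh [x0 fx0]]]]]] := exists_backward_chain aK sepX infX.
exists T; split; first by exists 3.
have [q qP] := dense_polynomials (newton h) dK.
have [|x [xM xq]] := exists_hypercyclic_vector q aK Th (D := 3) _ T3.
  by rewrite ler1n.
pose M := closure (range (newton h)).
have MP y : M y <-> forall e, 0 < e -> exists p, `|y - newton h p| <= e.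
  rewrite /M; split=> [/closure_normP yM e /yM[_ [p _ <-] yp]|yM]; first by exists p.
  by apply/closure_normP => e /yM[p yp]; exists (newton h p).
exists M, x; split.
- split; last exact: closed_closure.
  have M0 : M 0 by apply/MP => e e0; exists 0; rewrite linear0 subrr normr0 ltW.
  split; first exact: mem_set.
  move=> a y z /set_mem/MP yM /set_mem/MP zM; apply/mem_set/MP => e e0.
  have c0 : 0 < e / 2 / (1 + `|a|) by rewrite !divr_gt0// ltr_pwDl.
  have [p yp] := yM _ c0; have [r zr] := zM _ (divr_gt0 e0 (ltr0n _ 2)).
  exists (a *: p + r); rewrite linearP opprD addrACA -scalerBr.
  apply: le_trans (ler_normD _ _) _; rewrite normrZ.
  rewrite [e in leRHS]splitr lerD//.
  apply: le_trans (ler_wpM2l _ yp) _ => //.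
  by rewrite mulrCA ler_piMr ?divr_ge0 ?ltW// ltr_pdivrMr ?ltr_pwDl// mul1r ltrDr.
- move=> M0; have : M (h 0%N).
    by apply: subset_closure; exists 1 => //; rewrite newton1.
  by rewrite M0 /= => h00; rewrite h00 eqxx in h0.
- split=> // MT; have /MP x0M := MT x0 I.
  have [C C0 fC] := bounded_functionalW fb.
  have c0 : 0 < `|f x0 : K| / 2 / (1 + C).
    by rewrite !divr_gt0 ?normr_gt0// ltr_pwDl.
  have [p xp] := x0M _ c0.
  have fp : f (newton h p) = 0.
    by rewrite linear_sum big1// => j _; rewrite linearZ /= fh scaler0.
  have := fC (x0 - newton h p); rewrite linearB fp subr0 => fx.
  have : `|f x0 : K| < `|f x0 : K|; last by rewrite ltxx.
  apply: le_lt_trans fx _; apply: le_lt_trans (ler_wpM2l C0 xp) _.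
  have C1 : C / (1 + C) <= 1 by rewrite ler_pdivrMr ?ltr_pwDl// mul1r lerDr.
  have E (z : K) : C * (z / 2 / (1 + C)) = z * (2^-1 * (C / (1 + C))).
    by field; rewrite gt_eqF// ltr_pwDl.
  rewrite E.
  rewrite gtr_pMr ?normr_gt0//.
  apply: le_lt_trans (ler_wpM2l _ C1) _; first by rewrite invr_ge0.
  by rewrite mulr1 invf_lt1// ltr1n.
- move=> y /MP yM; apply/closure_normP => e e0.
  have e3 : 0 < e / 3 by rewrite divr_gt0.
  have [p yp] := yM _ e3.
  have [N Ne] := geometric_small aK (ler0n K 2) e3.
  have [k Nk pk] := qP p _ N e3; have [n xn] := xq k.
  exists (iter n T x).
    split; first by exists n.
    by apply/MP; exact: xM.
  have -> : y - iter n T x = (y - newton h p) +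
     (newton h p - newton h (q k)) + (newton h (q k) - iter n T x).
    by rewrite !addrA !subrK.
  have third (z : K) : z = z / 3 + z / 3 + z / 3 by field.
  rewrite [leRHS]third.
  apply: le_trans (ler_normD _ _) _; apply: lerD.
    by apply: le_trans (ler_normD _ _) _; apply: lerD.
  rewrite distrC; apply: le_trans xn _; apply: le_trans (ltW Ne).
  by rewrite ler_wpM2l// ler_wiXn2l// ?invr_ge0// invf_le1// ler1n.
Qed.

(** * The real and the complex scalars *)

Lemma archimedean_real (R : realType) : archimedean R.
Proof.
move=> x; exists (Num.bound `|x|).
exact/ltW/archi_boundP.
Qed.

Lemma archimedean_complex (R : realType) : archimedean R[i].
Proof.
move=> z; have [n zn] := archimedean_real (complex.Re `|z|).
exists n; rewrite -[`|z|](RRe_real (normr_real z)) -(rmorph_nat (real_complex R)).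
by rewrite lecR (le_trans (ler_norm _)).
Qed.

Lemma countably_dense_real (R : realType) : countably_dense R.
Proof.
exists (fun n => if (unpickle n : option rat) is Some r
                 then ratr r else 0) => z e e0.
have : z - e < z + e by rewrite ltrBlDr -addrA ltrDl addr_gt0.
move=> /rat_in_itvoo[r]; rewrite in_itv /= => /andP[rl rr].
exists (pickle r); rewrite pickleK distrC ler_distl.
by rewrite !ltW.
Qed.

Lemma countably_dense_complex (R : realType) : countably_dense R[i].
Proof.
have [d dP] := countably_dense_real R.
exists (fun n => if (unpickle n : option (nat * nat)) is Some (a, b)
                 then (d a +i* d b)%C else 0).
move=> [x y] e e0.
have eE : e = ((complex.Re e)%:C)%C by rewrite RRe_real// gtr0_real.
have e20 : 0 < complex.Re e / 2 by rewrite divr_gt0// -ltcR -eE.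
have [a xa] := dP x _ e20; have [b yb] := dP y _ e20.
exists (pickle (a, b)); rewrite pickleK.
rewrite eE; apply: le_trans (normc_le_ReIm _) _ => /=.
rewrite lecR [leRHS]splitr; exact: lerD.
Qed.

Unset Implicit Arguments.

Theorem theorem1 (R : realType) :
  (forall X : completeNormedModType R, infinite_dimensional X ->
     exists T : {linear X -> X}, bounded_operator T /\ subspace_hypercyclic T) /\
  (forall X : completeNormedModType (R[i])%C, infinite_dimensional X ->
     exists T : {linear X -> X}, bounded_operator T /\ subspace_hypercyclic T).
Proof.
split=> X infX; apply: subspace_hypercyclic_operator => //.
- exact: archimedean_real.
- exact: countably_dense_real.
- exact: separating_real.
- exact: archimedean_complex.
- exact: countably_dense_complex.
- exact: separating_complex.
Qed.
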